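(* Let $(A,\circ,\mathcal B(\cdot,\cdot))$ be a quadratic Novikov algebra, $\varphi:A\to A^*$ the linear map defined by $\langle\varphi(a),b\rangle=\mathcal B(a,b)$, $r\in A\otimes A$ and $\kappa\in\mathbf k$. Let $\hat r=\alpha+\beta$ with $\alpha=(\hat r-\hat r^t)/2$ and $\beta=(\hat r+\hat r^t)/2$, and suppose that $\check\beta=(r+\tau r)/2\in A\otimes A$ is invariant. Put $\bar\alpha=\alpha\varphi:A\to A$ and $\bar\beta=\beta\varphi:A\to A$. (i) $r$ is a solution of the extended Novikov Yang-Baxter equation of mass $\frac{\kappa+1}{4}$ in $A$ if and only if $\bar\alpha$ is an extended $\mathcal O$-operator of weight $0$ with extension $\bar\beta$ of mass $(\kappa,0)$ on $(A,\circ)$ associated to $(A,\circ,L_A,R_A)$. (ii) $r$ is a solution of the Novikov Yang-Baxter equation in $A$ if and only if $\bar\alpha$ is an extended $\mathcal O$-operator of weight $0$ with extension $\bar\beta$ of mass $(-1,0)$ on $(A,\circ)$ associated to $(A,\circ,L_A,R_A)$. In particular, if $r$ is skew-symmetric, then $r$ is a solution of the Novikov Yang-Baxter equation in $A$ if and only if $\bar\alpha$ is a Rota-Baxter operator of weight $0$, i.e. $\bar\alpha(x)\circ\bar\alpha(y)=\bar\alpha(\bar\alpha(x)\circ y+x\circ\bar\alpha(y))$ for all $x,y\in A$.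
   Context: $\mathbf k$ is a field of characteristic zero; all vector spaces are finite-dimensional over $\mathbf k$. A Novikov algebra $(A,\circ)$ is a vector space with a bilinear operation satisfying $(a\circ b)\circ c-a\circ(b\circ c)=(b\circ a)\circ c-b\circ(a\circ c)$ and $(a\circ b)\circ c=(a\circ c)\circ b$ for all $a,b,c\in A$. Put $a\star b=a\circ b+b\circ a$, $L_A(a)b=a\circ b$, $R_A(a)b=b\circ a$, $L_{A,\star}=L_A+R_A$. A quadratic Novikov algebra is a Novikov algebra with a nondegenerate symmetric bilinear form $\mathcal B$ that is invariant: $\mathcal B(a\circ b,c)=-\mathcal B(b,a\star c)$ for all $a,b,c$. For $r\in A\otimes A$, $\hat r,\hat r^t:A^*\to A$ are defined by $\langle\hat r(a^* ),b^*\rangle=\langle a^*\otimes b^*,r\rangle$ and $\langle a^*,\hat r^t(b^* )\rangle=\langle a^*\otimes b^*,r\rangle$. $\tau(a\otimes b)=b\otimes a$; $r$ is skew-symmetric if $\tau r=-r$. A symmetric $s\in A\otimes A$ is invariant if $(L_A(x)\otimes\mathrm{id}+\mathrm{id}\otimes L_{A,\star}(x))s=0$ for all $x\in A$. For linear maps $\alpha',\beta':A\to A$, $\alpha'$ is an extended $\mathcal O$-operator of weight $0$ with extension $\beta'$ of mass $(\kappa,0)$ on $(A,\circ)$ associated to $(A,\circ,L_A,R_A)$ if for all $x,y\in A$: $\beta'(x)\circ y=x\circ\beta'(y)$ ($\beta'$ balanced); $\kappa\,(x\circ\beta'(y))=\kappa\,\beta'(x\circ y)$ and $\kappa\,(\beta'(x)\circ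 y)=\kappa\,\beta'(x\circ y)$ ($\beta'$ $A$-invariant of mass $\kappa$); and $\alpha'(x)\circ\alpha'(y)-\alpha'(\alpha'(x)\circ y+x\circ\alpha'(y))=\kappa\,\beta'(x)\circ\beta'(y)$. For $r=\sum_i x_i\otimes y_i$, $r'=\sum_j x'_j\otimes y'_j$: $r_{13}\circ r'_{23}=\sum x_i\otimes x'_j\otimes y_i\circ y'_j$, $r_{12}\star r'_{23}=\sum x_i\otimes y_i\star x'_j\otimes y'_j$, $r_{13}\circ r'_{12}=\sum x_i\circ x'_j\otimes y'_j\otimes y_i$. The extended Novikov Yang-Baxter equation of mass $\epsilon\in\mathbf k$ in $A$ is $r_{13}\circ r_{23}+r_{12}\star r_{23}+r_{13}\circ r_{12}=\epsilon\,(r_{13}+(\tau r)_{13})\circ(r_{23}+(\tau r)_{23})$; the Novikov Yang-Baxter equation is the case $\epsilon=0$. *)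

(* Defs.v *)
From HB Require Import structures.
From mathcomp Require Import all_boot all_order all_algebra.

Set Implicit Arguments.
Unset Strict Implicit.
Unset Printing Implicit Defensive.

Import GRing.Theory.
Local Open Scope ring_scope.

Declare Scope tensor_scope.
Local Open Scope tensor_scope.

(* The tensor product of U and V is modelled by coefficient matrices with
   respect to the bases vbasis {:U} and vbasis {:V}. It is only ever accessed
   through [tens] and [tlift], which are related by the universal property
   ([tlift_tens], [tensE]). *)
Section Tensor.
Variable k : fieldType.

Definition tensor (U V : vectType k) : vectType k :=
  'M[k]_(\dim {:U}, \dim {:V}).

Definition tens (U V : vectType k) (u : U) (v : V) : tensor U V :=
  \matrix_(i, j) (coord (vbasis {:U}) i u * coord (vbasis {:V}) j v).

(* The linear map on U (x) V sending u (x) v to f u v: since f is an arbitrary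
   function here, this reading is only correct when f is bilinear, which is
   the case at every use below. *)
Definition tlift (U V : vectType k) (W : lmodType k) (f : U -> V -> W)
    (t : tensor U V) : W :=
  \sum_i \sum_j
    (t : 'M_(_, _)) i j *: f (vbasis {:U})`_i (vbasis {:V})`_j.

End Tensor.

Notation "u ⊗ v" := (tens u v)
  (at level 40, left associativity) : tensor_scope.

Section TensorTheory.
Variables (k : fieldType) (U V : vectType k).

Lemma tlift_is_linear (W : lmodType k) (f : U -> V -> W) : linear (tlift f).
Proof.
move=> c s t; rewrite /tlift scaler_sumr -big_split; apply: eq_bigr => i _ /=.
rewrite scaler_sumr -big_split; apply: eq_bigr => j _ /=.
by rewrite !mxE scalerDl scalerA.
Qed.

HB.instance Definition _ (W : lmodType k) (f : U -> V -> W) :=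
  GRing.isLinear.Build k (tensor U V) W *:%R (tlift f) (tlift_is_linear f).

Lemma tlift_tens (W : lmodType k) (f : U -> V -> W) :
    (forall v, linear (f^~ v)) -> (forall u, linear (f u)) ->
  forall u v, tlift f (u ⊗ v) = f u v.
Proof.
move=> fl fr u v.
pose lmk (T : vectType k) (g : T -> W) (gl : linear g) : {linear T -> W} :=
  HB.pack g (GRing.isLinear.Build k T W *:%R g gl).
have fsum (T : vectType k) (g : T -> W) (gl : linear g) (x : T) :
    g x = \sum_i coord (vbasis {:T}) i x *: g (vbasis {:T})`_i.
  rewrite {1}(coord_vbasis (memvf x)) -[g]/(lmk T g gl : T -> W) linear_sum.
  by apply: eq_bigr => i _; rewrite linearZ.
rewrite [RHS](fsum _ _ (fl v)); apply: eq_bigr => i _.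
rewrite (fsum _ _ (fr _) v) scaler_sumr; apply: eq_bigr => j _.
by rewrite mxE scalerA.
Qed.

Lemma tensE (t : tensor U V) :
  t = \sum_i \sum_j
        (t : 'M_(_, _)) i j *: ((vbasis {:U})`_i ⊗ (vbasis {:V})`_j).
Proof.
have E (T : vectType k) (i i' : 'I_(\dim {:T})) :
    coord (vbasis {:T}) i (vbasis {:T})`_i' = (i == i')%:R.
  by rewrite coord_free ?(eq_sym i) //; exact: basis_free (vbasisP _).
apply/matrixP => i j; rewrite summxE (bigD1 i) //= [X in _ + X]big1 => [|i' ne].
  rewrite addr0 summxE (bigD1 j) //= [X in _ + X]big1 => [|j' ne].
    by rewrite addr0 !mxE !E !eqxx !mulr1.
  by rewrite !mxE !E [j == j']eq_sym (negPf ne) !mulr0.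
rewrite summxE big1 // => j' _.
by rewrite !mxE !E [i == i']eq_sym (negPf ne) mul0r mulr0.
Qed.

Lemma tlift_fun_linear (T W : lmodType k) (F : T -> U -> V -> W)
    (t : tensor U V) :
  (forall u v, linear (fun x => F x u v)) -> linear (fun x => tlift (F x) t).
Proof.
move=> lin c x y; rewrite /tlift scaler_sumr -big_split; apply: eq_bigr => i _.
rewrite /= scaler_sumr -big_split; apply: eq_bigr => j _ /=.
by rewrite lin scalerDr !scalerA [c * _]mulrC.
Qed.

Lemma tens_linearl v : linear (fun u : U => u ⊗ v : tensor U V).
Proof.
by move=> c u u'; apply/matrixP => i j; rewrite !mxE linearP mulrDl mulrA.
Qed.

Lemma tens_linearr u : linear (fun v : V => u ⊗ v : tensor U V).
Proof.
by move=> c v v'; apply/matrixP => i j; rewrite !mxE linearP mulrDr mulrCA.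
Qed.

End TensorTheory.

Lemma tlift2_sum (k : fieldType) (A : vectType k) (W : lmodType k)
    (F : A -> A -> A -> A -> W) :
    (forall y x' y', linear (fun x => F x y x' y')) ->
    (forall x x' y', linear (fun y => F x y x' y')) ->
    (forall x y y', linear (fun x' => F x y x' y')) ->
    (forall x y x', linear (F x y x')) ->
  forall (I J : finType) (x y : I -> A) (x' y' : J -> A),
    tlift (fun a b => tlift (F a b) (\sum_j x' j ⊗ y' j)) (\sum_i x i ⊗ y i)
    = \sum_i \sum_j F (x i) (y i) (x' j) (y' j).
Proof.
move=> F1 F2 F3 F4 I J x y x' y'.
have G a b : tlift (F a b) (\sum_j x' j ⊗ y' j) = \sum_j F a b (x' j) (y' j).
  rewrite linear_sum; apply: eq_bigr => j _ /=.
  by rewrite tlift_tens.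
rewrite linear_sum; apply: eq_bigr => i _ /=; rewrite tlift_tens ?G //.
  by move=> v; apply: tlift_fun_linear => x0 y0; apply: F1.
by move=> u; apply: tlift_fun_linear => x0 y0; apply: F2.
Qed.

Definition dual (k : fieldType) (A : vectType k) : vectType k := 'Hom(A, k^o).

Section TensorSquare.
Variables (k : fieldType) (A : vectType k).
Implicit Types (r : tensor A A) (a b : dual A).

Definition flip r : tensor A A := tlift (fun x y => y ⊗ x) r.

Definition tmap (f g : A -> A) r : tensor A A :=
  tlift (fun x y => f x ⊗ g y) r.

Definition tpair a b r : k := tlift (fun x y => a x * b y : k^o) r.

(* The map A^* -> A called \hat r; its defining property is [hatP]. *)
Definition hat r : 'Hom(dual A, A) :=
  linfun (fun a => tlift (fun x y => a x *: y) r).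

(* The map A^* -> A called \hat r^t; its defining property is [hattP]. *)
Definition hatt r : 'Hom(dual A, A) :=
  linfun (fun b => tlift (fun x y => b y *: x) r).

Lemma hatP r a b : b (hat r a) = tpair a b r.
Proof.
have lin : linear (fun a : dual A => tlift (fun x y => a x *: y) r).
  apply: tlift_fun_linear => x y c u v.
  by rewrite add_lfunE scale_lfunE scalerDl -scalerA.
pose f : {linear dual A -> A} :=
  HB.pack (fun a : dual A => tlift (fun x y => a x *: y) r)
    (GRing.isLinear.Build k (dual A) A *:%R _ lin).
rewrite /hat (lfunE f) /= /tpair /tlift linear_sum.
apply: eq_bigr => i _; rewrite linear_sum; apply: eq_bigr => j _.
by rewrite 2![in LHS]linearZ.
Qed.

Lemma hattP r a b : a (hatt r b) = tpair a b r.
Proof.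
have lin : linear (fun b : dual A => tlift (fun x y => b y *: x) r).
  apply: tlift_fun_linear => x y c u v.
  by rewrite add_lfunE scale_lfunE scalerDl -scalerA.
pose f : {linear dual A -> A} :=
  HB.pack (fun b : dual A => tlift (fun x y => b y *: x) r)
    (GRing.isLinear.Build k (dual A) A *:%R _ lin).
rewrite /hatt (lfunE f) /= /tpair /tlift linear_sum.
apply: eq_bigr => i _; rewrite linear_sum; apply: eq_bigr => j _.
by rewrite 2![in LHS]linearZ /= [b _ *: _]mulrC.
Qed.

End TensorSquare.

Section Novikov.
Variables (k : fieldType) (A : vectType k) (mul : {bilinear A -> A -> A}).
Local Notation "x ∘ y" := (mul x y) (at level 40, left associativity).

Definition novikov : Prop :=
  (forall a b c, (a ∘ b) ∘ c - a ∘ (b ∘ c) = (b ∘ a) ∘ c - b ∘ (a ∘ c)) /\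
  (forall a b c, (a ∘ b) ∘ c = (a ∘ c) ∘ b).

Definition star (a b : A) : A := a ∘ b + b ∘ a.

Record quadratic_novikov (B : {symmetric A}) : Prop := QuadraticNovikov {
  quadratic_novikovP : novikov;
  quadratic_nondegenerate : nondegenerate B;
  quadratic_invariant : forall a b c, B (a ∘ b) c = - B b (star a c)
}.

Definition invariant_tensor (s : tensor A A) : Prop :=
  forall x : A, tmap (mul x) id s + tmap id (star x) s = 0.

Definition circ_13_23 (r r' : tensor A A) : tensor (tensor A A) A :=
  tlift (fun x y => tlift (fun x' y' => x ⊗ x' ⊗ (y ∘ y')) r') r.

Definition star_12_23 (r r' : tensor A A) : tensor (tensor A A) A :=
  tlift (fun x y => tlift (fun x' y' => x ⊗ star y x' ⊗ y') r') r.

Definition circ_13_12 (r r' : tensor A A) : tensor (tensor A A) A :=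
  tlift (fun x y => tlift (fun x' y' => (x ∘ x') ⊗ y' ⊗ y) r') r.

Let mulLl y : linear (fun x => x ∘ y).
Proof. by move=> c u v; rewrite linearDl linearZl_LR. Qed.

Let mulLr x : linear (fun y => x ∘ y).
Proof. by move=> c u v; rewrite linearDr linearZr_LR. Qed.

Section Sums.
Variables (I J : finType) (x y : I -> A) (x' y' : J -> A).
Let r := \sum_i x i ⊗ y i.
Let r' := \sum_j x' j ⊗ y' j.

Lemma circ_13_23E :
  circ_13_23 r r' = \sum_i \sum_j x i ⊗ x' j ⊗ (y i ∘ y' j).
Proof.
rewrite /circ_13_23 (tlift2_sum (F := fun x y x' y' => x ⊗ x' ⊗ (y ∘ y'))) //.
- by move=> b a' b' c u v; rewrite !tens_linearl.
- by move=> a a' b' c u v; rewrite mulLl tens_linearr.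
- by move=> a b b' c u v; rewrite tens_linearr tens_linearl.
- by move=> a b a' c u v; rewrite mulLr tens_linearr.
Qed.

Lemma star_12_23E :
  star_12_23 r r' = \sum_i \sum_j x i ⊗ star (y i) (x' j) ⊗ y' j.
Proof.
have sl z : linear (star^~ z).
  by move=> c u v; rewrite /star mulLl mulLr scalerDr addrACA.
have sr z : linear (star z).
  by move=> c u v; rewrite /star mulLl mulLr scalerDr addrACA.
rewrite /star_12_23 (tlift2_sum (F := fun x y x' y' => x ⊗ star y x' ⊗ y')) //.
- by move=> b a' b' c u v; rewrite !tens_linearl.
- by move=> a a' b' c u v; rewrite sl tens_linearr tens_linearl.
- by move=> a b b' c u v; rewrite sr tens_linearr tens_linearl.
- by move=> a b a' c u v; rewrite tens_linearr.
Qed.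

Lemma circ_13_12E :
  circ_13_12 r r' = \sum_i \sum_j (x i ∘ x' j) ⊗ y' j ⊗ y i.
Proof.
rewrite /circ_13_12 (tlift2_sum (F := fun x y x' y' => (x ∘ x') ⊗ y' ⊗ y)) //.
- by move=> b a' b' c u v; rewrite mulLl !tens_linearl.
- by move=> a a' b' c u v; rewrite tens_linearr.
- by move=> a b b' c u v; rewrite mulLr !tens_linearl.
- by move=> a b a' c u v; rewrite tens_linearr tens_linearl.
Qed.

End Sums.

(* On the right, (r_13 + (tau r)_13) o (r_23 + (tau r)_23) is the operation
   s_13 o s_23 for s = r + tau r. *)
Definition extended_NYBE (e : k) (r : tensor A A) : Prop :=
  circ_13_23 r r + star_12_23 r r + circ_13_12 r r =
  e *: circ_13_23 (r + flip r) (r + flip r).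

Definition NYBE (r : tensor A A) : Prop := extended_NYBE 0 r.

Definition balanced (beta : 'End(A)) : Prop :=
  forall x y, beta x ∘ y = x ∘ beta y.

Definition mass_invariant (kappa : k) (beta : 'End(A)) : Prop :=
  forall x y, kappa *: (x ∘ beta y) = kappa *: beta (x ∘ y) /\
              kappa *: (beta x ∘ y) = kappa *: beta (x ∘ y).

(* Extended O-operators of weight 0 and mass (kappa, 0) for the adjoint
   bimodule (A, L_A, R_A). *)
Definition extended_O_operator (kappa : k) (alpha beta : 'End(A)) : Prop :=
  [/\ balanced beta, mass_invariant kappa beta &
      forall x y, alpha x ∘ alpha y - alpha (alpha x ∘ y + x ∘ alpha y) =
                  kappa *: (beta x ∘ beta y)].

Definition rota_baxter0 (alpha : 'End(A)) : Prop :=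
  forall x y, alpha x ∘ alpha y = alpha (alpha x ∘ y + x ∘ alpha y).

End Novikov.

Definition form_dual (k : fieldType) (A : vectType k) (B : {symmetric A}) :
  'Hom(A, dual A) := linfun (fun a => linfun (B a : A -> k^o) : dual A).

Lemma form_dualE (k : fieldType) (A : vectType k) (B : {symmetric A}) a b :
  form_dual B a b = B a b.
Proof.
have linB c : linear (B c : A -> k^o).
  by move=> z x y; rewrite linearD linearZ.
pose g c : {linear A -> k^o} :=
  HB.pack (B c : A -> k^o) (GRing.isLinear.Build k A k^o *:%R _ (linB c)).
have gE c : linfun (B c : A -> k^o) =1 B c by move=> x; exact: (lfunE (g c)).
have lin : linear (fun a => linfun (B a : A -> k^o) : dual A).
  move=> z x y; apply/lfunP => w.
  by rewrite add_lfunE scale_lfunE !gE linearDl linearZl_LR.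
pose h : {linear A -> dual A} :=
  HB.pack (fun a => linfun (B a : A -> k^o) : dual A)
    (GRing.isLinear.Build k A (dual A) *:%R _ lin).
by rewrite /form_dual (lfunE h) gE.
Qed.

(* Main.v *)
(* Contract the three tensor slots with B(x,-), B(y,-), B(z,-). Since
   \hat r^t φ is the B-adjoint of \hat r φ, and invariance of B moves L(x) to
   -L_star(x) and makes every R(x) self-adjoint, the equation of mass
   e for r becomes, where X = \bar\alpha, Y = \bar\beta,
   P = \hat r φ = X + Y and Q = \hat r^t φ = Y - X,
     P x ∘ P y - P (P x ∘ y) + P (x ∘ Q y) = 4e (Y x ∘ Y y).
   Invariance of the symmetric part of r says that Y commutes with all L(x) and
   R(x); hence the left-hand side collapses to
     X x ∘ X y - X (X x ∘ y + x ∘ X y) + Y x ∘ Y y,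
   and the balancedness and invariance conditions on Y hold automatically. *)

From HB Require Import structures.
Require Import Defs.
From mathcomp Require Import all_boot all_order all_algebra.
Import GRing.Theory.
Local Open Scope ring_scope.
Local Open Scope tensor_scope.

Set Implicit Arguments.
Unset Strict Implicit.
Unset Printing Implicit Defensive.

(** * Linear maps out of a tensor product *)

Section TensorFacts.
Variables (k : fieldType) (U V : vectType k).

(** Stated for a bare function [g], so that contractions can be pulled through [tlift] without
    packing each of them as a linear map. *)
Lemma linear_tlift (W W' : lmodType k) (g : W -> W') (f : U -> V -> W)
    (t : tensor U V) :
  linear g -> g (tlift f t) = tlift (fun u v => g (f u v)) t.
Proof.
move=> lg.
pose h : {linear W -> W'} := HB.pack g (GRing.isLinear.Build k W W' *:%R g lg).
rewrite -[g]/(h : W -> W') /tlift linear_sum; apply: eq_bigr => i _.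
by rewrite linear_sum; apply: eq_bigr => j _; rewrite linearZ.
Qed.

Lemma eq_tlift (W : lmodType k) (f g : U -> V -> W) (t : tensor U V) :
  f =2 g -> tlift f t = tlift g t.
Proof. by move=> fg; do 2!apply: eq_bigr => ? _; rewrite fg. Qed.

(** Contracting with the [j]-th coordinate form of [V] and then taking the [i]-th coordinate in [U]
    reads off the matrix entry [t i j]. *)
Lemma tensor_eq0 (t : tensor U V) :
  (forall b : dual V, tlift (fun u v => b v *: u) t = 0) -> t = 0.
Proof.
move=> t0; apply/matrixP => i j; rewrite mxE.
have E (T : vectType k) (l l' : 'I_(\dim {:T})) :
    coord (vbasis {:T}) l (vbasis {:T})`_l' = (l == l')%:R.
  by rewrite coord_free ?(eq_sym l) //; exact: basis_free (vbasisP _).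
pose g : {linear V -> k^o} := coord (vbasis {:V}) j.
move/(congr1 (coord (vbasis {:U}) i)): (t0 (linfun g)).
rewrite linear0 /tlift linear_sum (bigD1 i) //= [X in _ + X]big1 => [|i' ne].
  rewrite addr0 linear_sum (bigD1 j) //= [X in _ + X]big1 => [|j' ne].
    by rewrite addr0 lfunE /= !linearZ /= !E !eqxx /= !mulr1.
  by rewrite lfunE /= !linearZ /= !E [j == _]eq_sym (negPf ne) mul0r mulr0.
rewrite linear_sum big1 // => j' _.
by rewrite lfunE /= !linearZ /= !E [i == _]eq_sym (negPf ne) !mulr0.
Qed.

End TensorFacts.

(** * Contraction of tensors with linear forms *)

Section TensorSquareFacts.
Variables (k : fieldType) (A : vectType k).
Implicit Types (r : tensor A A) (a b c : dual A).

Lemma hatE r a : hat r a = tlift (fun x y => a x *: y) r.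
Proof.
have lin : linear (fun a : dual A => tlift (fun x y => a x *: y) r).
  apply: tlift_fun_linear => x y c u v.
  by rewrite add_lfunE scale_lfunE scalerDl -scalerA.
exact: (lfunE (HB.pack (fun a : dual A => tlift (fun x y => a x *: y) r)
    (GRing.isLinear.Build k (dual A) A *:%R _ lin) : {linear dual A -> A})).
Qed.

Lemma hattE r b : hatt r b = tlift (fun x y => b y *: x) r.
Proof.
have lin : linear (fun b : dual A => tlift (fun x y => b y *: x) r).
  apply: tlift_fun_linear => x y c u v.
  by rewrite add_lfunE scale_lfunE scalerDl -scalerA.
exact: (lfunE (HB.pack (fun b : dual A => tlift (fun x y => b y *: x) r)
    (GRing.isLinear.Build k (dual A) A *:%R _ lin) : {linear dual A -> A})).
Qed.

Lemma hatD r s : hat (r + s) = hat r + hat s.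
Proof. by apply/lfunP => a; rewrite lfunE /= !hatE linearD. Qed.

Lemma hatZ e r : hat (e *: r) = e *: hat r.
Proof. by apply/lfunP => a; rewrite lfunE /= !hatE linearZ. Qed.

Lemma hattD r s : hatt (r + s) = hatt r + hatt s.
Proof. by apply/lfunP => a; rewrite lfunE /= !hattE linearD. Qed.

Lemma hattZ e r : hatt (e *: r) = e *: hatt r.
Proof. by apply/lfunP => a; rewrite lfunE /= !hattE linearZ. Qed.

Lemma tpair_linear a b : linear (tpair a b : tensor A A -> k^o).
Proof. by move=> e r s; rewrite /tpair linearP. Qed.

Lemma tpairD a b : {morph tpair a b : r s / r + s}.
Proof. by move=> r s; rewrite /tpair linearD. Qed.

Lemma tpair_tens a b x y : tpair a b (x ⊗ y) = a x * b y.
Proof.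
rewrite /tpair tlift_tens // => z e u v; rewrite linearP /=.
  by rewrite mulrDl -mulrA.
by rewrite mulrDr mulrCA.
Qed.

Lemma dual_eq0 (x : A) : (forall a, a x = 0) -> x = 0.
Proof.
move=> x0; rewrite (coord_vbasis (memvf x)) big1 // => i _.
pose g : {linear A -> k^o} := coord (vbasis {:A}) i.
by have := x0 (linfun g); rewrite lfunE /= => ->; rewrite scale0r.
Qed.

Lemma flip_tpair a b r : tpair a b (flip r) = tpair b a r.
Proof.
rewrite /flip (linear_tlift _ _ (tpair_linear a b)) [RHS]/tpair.
by apply: (eq_tlift (W := k^o)) => x y; rewrite tpair_tens mulrC.
Qed.

Lemma hat_flip r : hat (flip r) = hatt r.
Proof.
apply/lfunP => f; apply/eqP; rewrite -subr_eq0; apply/eqP.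
by apply: dual_eq0 => g; rewrite linearB /= hatP hattP flip_tpair subrr.
Qed.

Lemma hatt_flip r : hatt (flip r) = hat r.
Proof.
apply/lfunP => f; apply/eqP; rewrite -subr_eq0; apply/eqP.
by apply: dual_eq0 => g; rewrite linearB /= hatP hattP flip_tpair subrr.
Qed.

Definition tpair3 a b c (t : tensor (tensor A A) A) : k :=
  tlift (fun s z => c z *: (tpair a b s : k^o)) t.

Lemma tpair3_linear a b c :
  linear (tpair3 a b c : tensor (tensor A A) A -> k^o).
Proof. by move=> e r s; rewrite /tpair3 linearP. Qed.

Lemma tpair3D a b c : {morph tpair3 a b c : s t / s + t}.
Proof. by move=> s t; rewrite /tpair3 linearD. Qed.

Lemma tpair3Z a b c e t : tpair3 a b c (e *: t) = e * tpair3 a b c t.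
Proof. by rewrite /tpair3 linearZ. Qed.

Lemma tpair3_tens a b c x y z : tpair3 a b c (x ⊗ y ⊗ z) = a x * b y * c z.
Proof.
rewrite /tpair3 tlift_tens => [|v e s t|s e u v].
- by rewrite tpair_tens [RHS]mulrC.
- by rewrite tpair_linear scalerDr !scalerA mulrC.
- by rewrite linearP scalerDl scalerA.
Qed.

(** Linear forms separate the points of a triple tensor product: the slots are peeled off from the
    last to the first, two by [tensor_eq0] and the remaining vector by [dual_eq0]. *)
Lemma tpair3_inj (t t' : tensor (tensor A A) A) :
  (forall a b c, tpair3 a b c t = tpair3 a b c t') -> t = t'.
Proof.
move=> tt'; apply/eqP; rewrite -subr_eq0; apply/eqP.
apply: tensor_eq0 => c; apply: tensor_eq0 => b.
apply: dual_eq0 => a; rewrite -hattE hattP.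
rewrite (linear_tlift _ _ (tpair_linear a b)).
have <- : tpair3 a b c (t - t') = 0.
  by rewrite tpair3D -scaleN1r tpair3Z tt' mulN1r subrr.
by apply: (eq_tlift (W := k^o)) => s z; rewrite /tpair linearZ.
Qed.

End TensorSquareFacts.

(** * Contraction of the three products in the Yang-Baxter equation *)

Section Contractions.
Variables (k : fieldType) (A : vectType k) (mul : {bilinear A -> A -> A}).
Implicit Types (r : tensor A A) (a b c : dual A).
Local Notation "x ∘ y" := (mul x y) (at level 40, left associativity).

Let mulLl y : linear (fun x => x ∘ y).
Proof. by move=> c u v; rewrite linearDl linearZl_LR. Qed.

Let mulLr x : linear (fun y => x ∘ y).
Proof. by move=> c u v; rewrite linearDr linearZr_LR. Qed.

Lemma starC x y : star mul x y = star mul y x.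
Proof. by rewrite /star addrC. Qed.

Lemma star_linear x : linear (star mul x).
Proof. by move=> e u v; rewrite /star mulLl mulLr scalerDr addrACA. Qed.

Lemma star_linearl y : linear (star mul ^~ y).
Proof. by move=> e u v; rewrite /= ![star mul _ y]starC star_linear. Qed.

(** The product sits in the slot that the two tensors share. Each tensor is contracted in its other
    leg, which gives [hat] for a first leg and [hatt] for a second one. The next two lemmas follow
    the same pattern, with shared slots 2 and 1. *)
Lemma tpair3_circ_13_23 a b c r r' :
  tpair3 a b c (circ_13_23 mul r r') = c (hat r a ∘ hat r' b).
Proof.
rewrite /circ_13_23 (linear_tlift _ _ (tpair3_linear a b c)) hatE.
rewrite (linear_tlift (g := fun x => c (x ∘ _) : k^o)); last first.
  by move=> e u v; rewrite mulLl linearP.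
apply: (eq_tlift (W := k^o)) => x y.
rewrite (linear_tlift _ _ (tpair3_linear a b c)) hatE.
rewrite (linear_tlift (g := fun z => c (_ ∘ z) : k^o)); last first.
  by move=> e u v; rewrite mulLr linearP.
apply: (eq_tlift (W := k^o)) => x' y'; rewrite tpair3_tens.
by rewrite linearZl_LR linearZr_LR !linearZ -mulrA.
Qed.

Lemma tpair3_star_12_23 a b c r r' :
  tpair3 a b c (star_12_23 mul r r') = b (star mul (hat r a) (hatt r' c)).
Proof.
rewrite /star_12_23 (linear_tlift _ _ (tpair3_linear a b c)) hatE.
rewrite (linear_tlift (g := fun x => b (star mul x _) : k^o)); last first.
  by move=> e u v; rewrite star_linearl linearP.
apply: (eq_tlift (W := k^o)) => x y.
rewrite (linear_tlift _ _ (tpair3_linear a b c)) hattE.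
rewrite (linear_tlift (g := fun z => b (star mul _ z) : k^o)); last first.
  by move=> e u v; rewrite star_linear linearP.
apply: (eq_tlift (W := k^o)) => x' y'; rewrite tpair3_tens.
have -> : star mul (a x *: y) (c y' *: x') = (a x * c y') *: star mul y x'.
  rewrite /star !linearZl_LR !linearZr_LR /= !scalerA [c _ * _]mulrC.
  by rewrite -scalerDr.
by rewrite linearZ mulrAC.
Qed.

Lemma tpair3_circ_13_12 a b c r r' :
  tpair3 a b c (circ_13_12 mul r r') = a (hatt r c ∘ hatt r' b).
Proof.
rewrite /circ_13_12 (linear_tlift _ _ (tpair3_linear a b c)) hattE.
rewrite (linear_tlift (g := fun x => a (x ∘ _) : k^o)); last first.
  by move=> e u v; rewrite mulLl linearP.
apply: (eq_tlift (W := k^o)) => x y.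
rewrite (linear_tlift _ _ (tpair3_linear a b c)) hattE.
rewrite (linear_tlift (g := fun z => a (_ ∘ z) : k^o)); last first.
  by move=> e u v; rewrite mulLr linearP.
apply: (eq_tlift (W := k^o)) => x' y'; rewrite tpair3_tens.
by rewrite linearZl_LR linearZr_LR !linearZ mulrC [a _ * _]mulrC.
Qed.

Lemma tpair_tmap a b (f g : A -> A) r :
  tpair a b (tmap f g r) = tlift (fun x y => a (f x) * b (g y) : k^o) r.
Proof.
rewrite /tmap (linear_tlift _ _ (tpair_linear a b)).
by apply: (eq_tlift (W := k^o)) => x y; rewrite tpair_tens.
Qed.

End Contractions.

(** * Identification of A with its dual through B *)

Section Forms.
Variables (k : fieldType) (A : vectType k) (B : {symmetric A}).
Implicit Types (r : tensor A A) (x y : A).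

Lemma formC x y : B x y = B y x.
Proof. by rewrite hermC expr0 mul1r. Qed.

Lemma form_hat_adj r x y :
  B (hat r (form_dual B x)) y = B x (hatt r (form_dual B y)).
Proof. by rewrite formC -!form_dualE hatP hattP. Qed.

Lemma form_eq0 x : nondegenerate B -> (forall y, B y x = 0) -> x = 0.
Proof.
move=> /eqP ndB x0; apply/eqP; rewrite -memv0 -ndB.
by apply/mem_orthovP => y _; rewrite formC.
Qed.

(** Nondegeneracy makes [form_dual B] injective, and A and its dual have the same dimension. *)
Lemma form_dual_surj : nondegenerate B -> forall f, exists x, f = form_dual B x.
Proof.
move=> ndB f.
have ker0 : lker (form_dual B) = 0%VS.
  apply/eqP; rewrite -subv0; apply/subvP => x; rewrite memv_ker memv0.
  move=> /eqP x0; apply/eqP; apply: form_eq0 => // y.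
  by rewrite formC -form_dualE x0 zero_lfunE.
have: f \in limg (form_dual B).
  have /eqP -> : limg (form_dual B) == fullv; last exact: memvf.
  rewrite eqEdim subvf /= limg_dim_eq ?ker0 ?capv0 //.
  by rewrite !dimvf /dim /= muln1.
by move/memv_imgP => [x _ ->]; exists x.
Qed.

End Forms.

(** * Invariance and the Yang-Baxter equation in a quadratic Novikov algebra *)

Section Quadratic.
Variables (k : fieldType) (A : vectType k) (mul : {bilinear A -> A -> A}).
Variable B : {symmetric A}.
Hypothesis quadB : quadratic_novikov mul B.
Implicit Types (r s : tensor A A) (a b c x y : A).
Local Notation "x ∘ y" := (mul x y) (at level 40, left associativity).
Local Notation φ := (form_dual B).

Let ndB : nondegenerate B := quadratic_nondegenerate quadB.

Let form_inj x y : (forall z, B z x = B z y) -> x = y.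
Proof.
move=> xy; apply/eqP; rewrite -subr_eq0; apply/eqP.
by apply: (form_eq0 ndB) => z; rewrite linearB /= xy subrr.
Qed.

(** Invariance is applied to [B (a ∘ b) c], then to the term [B (a ∘ c) b] of the result. This
    brings back [B (a ∘ b) c], which cancels. *)
Lemma form_mulr_adj a b c : B (b ∘ a) c = B b (c ∘ a).
Proof.
have inv := quadratic_invariant quadB.
have := inv a b c; rewrite /star linearDr /= [B b (a ∘ c)]formC inv /star.
rewrite linearDr /= opprD opprK [B c (a ∘ b)]formC -addrA => /eqP.
rewrite -subr_eq0 opprD addrA subrr add0r opprB subr_eq0 => /eqP->.
by rewrite formC.
Qed.

(** The contracted invariance condition [key] can be read in either leg of s. One reading says that
    [hat s φ] commutes with every L(x), the other that it commutes with every L_star(x); the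
    difference gives R(x). *)
Lemma invariant_tensor_hat s : hat s = hatt s -> invariant_tensor mul s ->
  forall x y, hat s (φ (x ∘ y)) = hat s (φ x) ∘ y /\
              hat s (φ (x ∘ y)) = x ∘ hat s (φ y).
Proof.
move=> symm inv.
have inva := quadratic_invariant quadB.
(* The operators acting on s are moved to the arguments of the forms: up to sign, L(x) and L_star(x)
   are adjoint for B. *)
have key x a b :
    tpair (φ (star mul x a)) (φ b) s = - tpair (φ a) (φ (x ∘ b)) s.
  have oppl : linear (-%R : k^o -> k^o) by move=> e u v; rewrite linearP.
  have:= congr1 (tpair (φ a) (φ b)) (inv x).
  rewrite tpairD [tpair _ _ 0]linear0 !tpair_tmap.
  have -> : tlift (fun u v => φ a (x ∘ u) * φ b v : k^o) s
            = - tpair (φ (star mul x a)) (φ b) s.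
    rewrite /tpair (linear_tlift _ _ oppl).
    apply: (eq_tlift (W := k^o)) => u v.
    by rewrite !form_dualE formC inva formC mulNr.
  have -> : tlift (fun u v => φ a u * φ b (star mul x v) : k^o) s
            = - tpair (φ a) (φ (x ∘ b)) s.
    rewrite /tpair (linear_tlift _ _ oppl).
    apply: (eq_tlift (W := k^o)) => u v.
    by rewrite !form_dualE inva mulrN opprK.
  by rewrite -opprD => /eqP; rewrite oppr_eq0 addr_eq0 => /eqP.
have left x y : hat s (φ (x ∘ y)) = x ∘ hat s (φ y).
  apply: form_inj => z; apply: oppr_inj.
  rewrite -form_dualE symm hattP -key -hattP -symm form_dualE.
  by rewrite [in RHS]formC inva opprK formC.
have star_hat x y : hat s (φ (star mul x y)) = star mul x (hat s (φ y)).
  apply: form_inj => z.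
  rewrite -form_dualE hatP key -hatP form_dualE.
  by rewrite inva opprK.
move=> x y; split=> //.
have := star_hat y x; rewrite /star linearD /= [hat s _]linearD /= left.
by move/addrI.
Qed.

Lemma extended_NYBE_form e r :
  extended_NYBE mul e r <->
  forall x y,
    hat r (φ x) ∘ hat r (φ y) - hat r (φ (hat r (φ x) ∘ y))
      + hat r (φ (x ∘ hatt r (φ y))) =
    e *: (hat (r + flip r) (φ x) ∘ hat (r + flip r) (φ y)).
Proof.
have inva := quadratic_invariant quadB.
pose lhs := circ_13_23 mul r r + star_12_23 mul r r + circ_13_12 mul r r.
have lhsE x y z : tpair3 (φ x) (φ y) (φ z) lhs =
    B z (hat r (φ x) ∘ hat r (φ y) - hat r (φ (hat r (φ x) ∘ y))
         + hat r (φ (x ∘ hatt r (φ y)))).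
  rewrite /lhs !tpair3D tpair3_circ_13_23 tpair3_star_12_23 tpair3_circ_13_12.
  rewrite !form_dualE [RHS]linearD /= [B z (_ - _)]linearB /=.
  congr (_ + _ + _).
    (* Second term: invariance trades [star] for left multiplication on y, then [hatt r] moves
       across B. The third term, below, uses instead that right multiplications are self-adjoint. *)
    rewrite -[LHS]opprK -inva; congr (- _).
    by rewrite -form_hat_adj formC.
  by rewrite formC form_mulr_adj [RHS]formC form_hat_adj formC.
have rhsE x y z s : tpair3 (φ x) (φ y) (φ z) (e *: circ_13_23 mul s s) =
    B z (e *: (hat s (φ x) ∘ hat s (φ y))).
  by rewrite tpair3Z tpair3_circ_13_23 form_dualE linearZ_LR.
rewrite /extended_NYBE -/lhs; split=> [nybe x y|eqs].
  by apply: form_inj => z; rewrite -lhsE nybe rhsE.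
(* By nondegeneracy all functionals have the form [φ x], so the contracted equations determine the
   tensor equation. *)
apply: tpair3_inj => f g h.
have [x ->] := form_dual_surj ndB f; have [y ->] := form_dual_surj ndB g.
have [z ->] := form_dual_surj ndB h.
by rewrite lhsE rhsE eqs.
Qed.

End Quadratic.

(** * The equivalences with operator identities *)

Theorem corollary3p14 (k : fieldType) (A : vectType k)
  (mul : {bilinear A -> A -> A}) (B : {symmetric A})
  (r : tensor A A) (kappa : k) :
  [pchar k] =i pred0 ->
  quadratic_novikov mul B ->
  invariant_tensor mul (2%:R^-1 *: (r + flip r)) ->
  let alpha : 'Hom(dual A, A) := 2%:R^-1 *: (hat r - hatt r) in
  let beta : 'Hom(dual A, A) := 2%:R^-1 *: (hat r + hatt r) in
  let alphabar : 'End(A) := (alpha \o form_dual B)%VF in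
  let betabar : 'End(A) := (beta \o form_dual B)%VF in
  [/\ extended_NYBE mul ((kappa + 1) / 4%:R) r <->
        extended_O_operator mul kappa alphabar betabar,
      NYBE mul r <->
        extended_O_operator mul (-1) alphabar betabar &
      flip r = - r ->
        (NYBE mul r <-> rota_baxter0 mul alphabar)].
Proof.
move=> char0 quadB inv alpha beta X Y.
have nz n : n.+1%:R != 0 :> k by rewrite ((pcharf0P k).1 char0).
have half (x : A) : 2%:R^-1 *: (x *+ 2) = x.
  by rewrite -scaler_nat scalerA mulVf ?scale1r ?nz.
have YE x : Y x = 2%:R^-1 *: (hat r (form_dual B x) + hatt r (form_dual B x)).
  by rewrite comp_lfunE scale_lfunE add_lfunE.
have XE x : X x = 2%:R^-1 *: (hat r (form_dual B x) - hatt r (form_dual B x)).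
  by rewrite comp_lfunE scale_lfunE add_lfunE opp_lfunE.
have hatXY x : hat r (form_dual B x) = X x + Y x.
  by rewrite XE YE -scalerDr addrACA addNr addr0 -mulr2n half.
have hattXY x : hatt r (form_dual B x) = Y x - X x.
  by rewrite XE YE -scalerBr opprD opprK addrACA subrr add0r -mulr2n half.
have hat2Y x : hat (r + flip r) (form_dual B x) = 2%:R *: Y x.
  by rewrite YE scalerA mulfV ?nz // scale1r hatD hat_flip add_lfunE.
have Yinv x y : Y (mul x y) = mul (Y x) y /\ Y (mul x y) = mul x (Y y).
  (* Y comes from the symmetric part of r, to which the invariance hypothesis applies. *)
  have YsE z : Y z = hat (2%:R^-1 *: (r + flip r)) (form_dual B z).
    by rewrite hatZ hatD hat_flip comp_lfunE.
  rewrite !YsE; apply: invariant_tensor_hat => //.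
  by rewrite hatZ hattZ hatD hattD hat_flip hatt_flip addrC.
have YX x y : mul (Y x) y = mul x (Y y).
  by have [<- <-] := Yinv x y.
pose defect x y := mul (X x) (X y) - X (mul (X x) y + mul x (X y)).
(* In the factor [4e - 1], the 4 comes from [hat (r + flip r) φ = 2Y] in both arguments, and the 1
   from the term [Y x ∘ Y y] left over on the left-hand side. *)
have nybeE e : extended_NYBE mul e r <->
    forall x y, defect x y = (4%:R * e - 1) *: mul (Y x) (Y y).
  have resE x y : mul (hat r (form_dual B x)) (hat r (form_dual B y))
      - hat r (form_dual B (mul (hat r (form_dual B x)) y))
      + hat r (form_dual B (mul x (hatt r (form_dual B y)))) =
      defect x y + mul (Y x) (Y y).
    have e1 : mul (X x) (Y y) = Y (mul (X x) y) by have [] := Yinv (X x) y.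
    have e2 : mul (Y x) (X y) = Y (mul x (X y)) by have [] := Yinv x (X y).
    have e3 : mul (Y x) (Y y) = Y (Y (mul x y)).
      by have [<- _] := Yinv x (Y y); have [_ <-] := Yinv x y.
    have [/esym e4 /esym e5] := Yinv x y.
    rewrite !hatXY hattXY /defect linearDl !linearDr /= linearDl /= linearNr /=.
    rewrite !linearD !linearN /= e1 e2 e3 e4 e5.
    (* The twelve terms are sorted into [X x ∘ X y], the two terms of X applied to a sum, the
       surviving [Y x ∘ Y y] in the form [Y (Y (x ∘ y))], and four pairs that cancel. *)
    rewrite [LHS](AC (2*2*(2*2)*(2*2))
      (1*(5*10)*4*(2*7)*(3*12)*(9*6)*(11*8)))%AC /=.
    by rewrite !subrr !addr0.
  have sqE x y : mul (hat (r + flip r) (form_dual B x))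
      (hat (r + flip r) (form_dual B y)) = 4%:R *: mul (Y x) (Y y).
    by rewrite !hat2Y linearZl_LR linearZr_LR scalerA -natrM.
  have [fromN toN] := extended_NYBE_form quadB e r.
  split=> [/fromN eqs x y|eqs]; last apply: toN => x y.
    have := eqs x y; rewrite resE sqE scalerA mulrC => /(canRL (addrK _)) ->.
    by rewrite scalerBl scale1r.
  by rewrite resE sqE scalerA mulrC eqs scalerBl scale1r subrK.
have Oop c : extended_O_operator mul c X Y <->
    forall x y, defect x y = c *: mul (Y x) (Y y).
  split=> [[] //|eqs]; split=> // x y.
  by have [-> E] := Yinv x y; rewrite E.
have nybe_Oop e c : 4%:R * e - 1 = c ->
    extended_NYBE mul e r <-> extended_O_operator mul c X Y.
  by move=> <-; apply: iff_trans (nybeE e) (iff_sym (Oop _)).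
split.
- by apply: nybe_Oop; rewrite mulrC divfK ?nz // addrK.
- by apply: nybe_Oop; rewrite mulr0 sub0r.
move=> skew; apply: iff_trans (nybeE 0) _.
have Y0 x : Y x = 0.
  (* [nz 1] states that 2 is nonzero; [2Y] comes from [r + flip r], which vanishes here. *)
  by apply: (scalerI (nz 1)); rewrite -hat2Y skew subrr scaler0 hatE linear0.
split=> eqs x y.
  apply/eqP; rewrite -subr_eq0; apply/eqP.
  by rewrite -/(defect x y) eqs Y0 linear0l scaler0.
by rewrite Y0 linear0l scaler0 /defect eqs subrr.
Qed.
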